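(* Let $d$ be a Dyck path and $k\ge1$. Then $\mathrm{supp}(X_{G(d)}(x_1,\ldots,x_k))\subset\mathbb{N}^k$ is M-convex.
   Context: A Dyck path $d$ of length $n$ is a lattice path from $(0,0)$ to $(n,n)$ with steps $\mathsf{n}=(0,1)$ and $\mathsf{e}=(1,0)$ not going below $y=x$. Its Hessenberg function $h_d:[n]\to[n]$ is: $h_d(i)$ is the number of unit squares in column $i$ below $d$, i.e. the number of $\mathsf n$ steps preceding the $i$-th $\mathsf e$ step. The indifference graph $G(d)$ has vertex set $[n]$ with an edge between $i<j$ iff $j\le h_d(i)$. For a graph $G$, $X_G(x_1,\ldots,x_k)=\sum_f\prod_{v\in V(G)}x_{f(v)}$, summed over all proper colorings $f:V(G)\to[k]$ (adjacent vertices get different colors). The support $\mathrm{supp}(p)$ of a polynomial $p$ is the set of exponent vectors of monomials with nonzero coefficient. A set $J\subset\mathbb{N}^k$ is M-convex if for all $\alpha,\beta\in J$ and all $i$ with $\alpha_i>\beta_i$ there is $j$ with $\beta_j>\alpha_j$ and $\alpha-e_i+e_j\in J$, where $e_i$ are the standard unit vectors. *)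

(* Defs.v *)
From mathcomp Require Import all_boot all_order all_algebra.
From mathcomp Require Import mpoly.

Set Implicit Arguments.
Unset Strict Implicit.
Unset Printing Implicit Defensive.

Import GRing.Theory.
Local Open Scope ring_scope.

(* A lattice path is the word of its steps, as a sequence of booleans:
   true is the step n = (0,1) and false is the step e = (1,0). *)
Notation north := true (only parsing).
Notation east := false (only parsing).

(* After m steps the path is at (x, y), with x and y the numbers of e and n
   steps among the first m; it is not below the diagonal when x <= y. *)
Definition dyck_path (n : nat) (d : seq bool) : Prop :=
  [/\ count_mem north d = n, count_mem east d = n
    & forall m : nat,
        (count_mem east (take m d) <= count_mem north (take m d))%N].

Definition east_positions (d : seq bool) : seq nat :=
  [seq p <- iota 0 (size d) | nth north d p == east].

(* Indices are shifted by one: i : 'I_n stands for i.+1 in {1, ..., n}, so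
   hessenberg d i counts the n steps preceding the (i.+1)-st e step. *)
Definition hessenberg (d : seq bool) (i : nat) : nat :=
  count_mem north (take (nth 0%N (east_positions d) i) d).

(* i.+1 and j.+1 are the labels of i and j in {1, ..., n}; only the values of
   hessenberg are unshifted. *)
Definition indifference_graph (n : nat) (d : seq bool) : rel 'I_n :=
  fun i j => ((i < j)%N && (j.+1 <= hessenberg d i)%N)
          || ((j < i)%N && (i.+1 <= hessenberg d j)%N).
Arguments indifference_graph : clear implicits.

Definition proper_coloring (V : finType) (e : rel V) (k : nat)
    (f : {ffun V -> 'I_k}) : bool :=
  [forall u, forall v, e u v ==> (f u != f v)].

Definition chromatic_sympoly (V : finType) (e : rel V) (k : nat) :
    {mpoly int[k]} :=
  \sum_(f : {ffun V -> 'I_k} | proper_coloring e f) \prod_(v : V) 'X_(f v).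

(* Subtraction of multinomials is truncated, but here alpha i > beta i >= 0,
   so alpha - U_(i) is the true difference. *)
Definition M_convex (k : nat) (J : 'X_{1..k} -> Prop) : Prop :=
  forall alpha beta : 'X_{1..k}, J alpha -> J beta ->
  forall i : 'I_k, (beta i < alpha i)%N ->
  exists j : 'I_k,
    (alpha j < beta j)%N /\ J (alpha - U_(i) + U_(j))%MM.

(* Main.v *)
(** The exponents of [X_G] are the class sizes of proper colorings. Let [rho r]
    be the number of vertices that first fit (coloring the vertices from left to
    right) colors with the first [r] colors. In an indifference graph no [r]
    color classes cover more than [rho r] vertices, and [rho] is concave.
    Conversely a Kempe exchange moves one vertex from a larger color class to a
    smaller one, and such moves lead from the first-fit class sizes down to every
    vector [a] of total [n] with [a(S) <= rho #|S|] for all sets [S] of colors. So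
    the support is the set of bases of an integral polymatroid, and these satisfy
    the exchange property. *)
Require Import Defs.
From mathcomp Require Import all_boot all_order all_algebra.
From mathcomp Require Import perm.
From mathcomp Require Import mpoly.
From mathcomp Require Import zify.

Set Implicit Arguments.
Unset Strict Implicit.
Unset Printing Implicit Defensive.

(** * Colorings of the vertices below [n] and their class sizes *)

(** Two adjacent vertices and all those between them form a clique. An edge is read only from its
    smaller to its larger end. *)
Definition interval_rel (e : rel nat) (n : nat) : Prop :=
  forall u w v, u < w -> w < v -> v < n -> e u v -> e u w && e w v.

Definition proper_upto (T : eqType) (e : rel nat) (n : nat) (f : nat -> T) :=
  forall u v, u < v -> v < n -> e u v -> f u != f v.

Definition realizable (k : nat) (e : rel nat) (n : nat) (a : 'I_k -> nat) :=
  exists2 f : nat -> 'I_k, proper_upto e n f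
    & forall c, count (fun v => f v == c) (iota 0 n) = a c.

(** The vector [a - e_i + e_j]; the truncation of the subtraction is harmless when [0 < a i]. *)
Definition transfer (k : nat) (i j : 'I_k) (a : 'I_k -> nat) : 'I_k -> nat :=
  fun c => a c - (c == i) + (c == j).

Lemma count_iotaS (P : pred nat) m :
  count P (iota 0 m.+1) = count P (iota 0 m) + P m.
Proof. by rewrite -addn1 iotaD count_cat /= addn0. Qed.

Lemma sum_count_mem (T : eqType) (C : finType) (f : T -> C) (S : {set C}) s :
  \sum_(c in S) count (fun v => f v == c) s = count (fun v => f v \in S) s.
Proof.
elim: s => [|x s IHs] /=; first by rewrite big1.
rewrite big_split /= IHs; congr (_ + _).
rewrite -big_mkcondr /=; case: (boolP (f x \in S)) => fxS.
  rewrite (big_pred1 (f x)) // => c /=; rewrite (eq_sym c).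
  by case: eqVneq => [<-|]; rewrite ?fxS ?andbF.
rewrite big_pred0 // => c; case: eqVneq => [<-|]; by rewrite ?andbF // (negPf fxS).
Qed.

(** * Moving single vertices between color classes by Kempe exchanges *)

Lemma sum_transfer (k : nat) (i j : 'I_k) (a : 'I_k -> nat) (P : pred 'I_k) :
  0 < a i ->
  \sum_(c | P c) transfer i j a c + P i = \sum_(c | P c) a c + P j.
Proof.
move=> ai.
have indic x : \sum_(c | P c) (c == x : nat) = P x.
  rewrite big_mkcond (bigD1 x) //= eqxx big1 ?addn0; first by case: (P x).
  by move=> y /negPf ->; case: (P y).
rewrite -(indic i) -(indic j) -!big_split /=; apply: eq_bigr => c _.
by rewrite /transfer addnAC subnK //; case: (eqVneq c i) => [->|].
Qed.

(* A Kempe exchange done on a prefix: no edge with both ends colored [a] or [b]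
   crosses [q], so [a] and [b] may be swapped below [q], which turns exactly one
   vertex from [a] to [b]. *)
Lemma balanced_cut (T : eqType) (e : rel nat) n (f : nat -> T) (a b : T) :
  a != b -> interval_rel e n -> proper_upto e n f ->
  count (fun v => f v == b) (iota 0 n) < count (fun v => f v == a) (iota 0 n) ->
  exists q, count (fun v => f v == a) (iota 0 q)
            = (count (fun v => f v == b) (iota 0 q)).+1
    /\ q <= n
    /\ forall u v, u < q -> q <= v -> v < n -> e u v ->
         ~~ ((f u \in [:: a; b]) && (f v \in [:: a; b])).
Proof.
move=> nab he hf hlt.
pose A m := count (fun v => f v == a) (iota 0 m).
pose B m := count (fun v => f v == b) (iota 0 m).
pose good q := A q = (B q).+1 /\ q <= n /\
  forall u v, u < q -> q <= v -> v < n -> e u v ->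
         ~~ ((f u \in [:: a; b]) && (f v \in [:: a; b])).
(* Scanning from the left, either a cut has been found, or [a] does not lead, or [a] leads by
   exactly one and the last vertex [u] colored [a] or [b] has color [a]. *)
have inv m : m <= n -> (exists q, good q) \/ A m <= B m \/
    (A m = (B m).+1 /\ exists u, [/\ u < m, f u = a &
       forall w, u < w -> w < m -> f w \notin [:: a; b]]).
  elim: m => [|m IHm] mn; first by right; left.
  have AS : A m.+1 = A m + (f m == a) by apply: count_iotaS.
  have BS : B m.+1 = B m + (f m == b) by apply: count_iotaS.
  case: (IHm (ltnW mn)) => [|[leAB|[eqAB [u [um fu hu]]]]]; first by left.
    right; move: AS BS; case: (eqVneq (f m) a) => [fma|nma] AS BS.
      move: BS; rewrite fma (negPf nab) => BS.
      have [?|?] := ltnP (A m) (B m); first by left; lia.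
      right; split; first by lia.
      exists m; split=> // w; lia.
    by left; lia.
  case: (eqVneq (f m) a) AS => [fma|nma] AS; last first.
    case: (eqVneq (f m) b) BS => [fmb|nmb] BS; first by right; left; lia.
    right; right; split; first by lia.
    exists u; split=> // [|w uw]; first by lia.
    rewrite ltnS leq_eqVlt => /orP[/eqP ->|]; last exact: hu.
    by rewrite !inE negb_or nma.
  (* A second [a] in a row: cut before [m]. A crossing edge between these colors would start at or
     before [u] and so make [u] and [m], both colored [a], adjacent. *)
  left; exists m; split=> //; split=> [|x v xm mv vn exv]; first exact: ltnW.
  apply/negP => /andP[fx fv].
  have xu : x <= u.
    by rewrite leqNgt; apply/negP => ux; move: (hu x ux xm); rewrite fx.
  have um_e : e x m -> False.
    rewrite leq_eqVlt in xu; case/orP: xu => [/eqP -> eum|xu exm].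
      by have := hf _ _ um mn eum; rewrite fu fma eqxx.
    have /andP[_ eum] := he _ _ _ xu um mn exm.
    by have := hf _ _ um mn eum; rewrite fu fma eqxx.
  move: mv; rewrite leq_eqVlt => /orP[/eqP mv|mv]; first by apply: um_e; rewrite mv.
  by have /andP[exm _] := he _ _ _ xm mv vn exv; apply: um_e.
case: (inv n (leqnn n)) => [//|[|[eqAB _]]]; first by rewrite leqNgt hlt.
exists n; split=> //; split=> // u v _ nv; by rewrite ltnNge nv.
Qed.

Lemma realizable_transfer (k : nat) e n (g : 'I_k -> nat) (a b : 'I_k) :
  interval_rel e n -> realizable e n g -> g b < g a ->
  realizable e n (transfer a b g).
Proof.
move=> he [f hf fg] ltba.
have nab : a != b by apply: contraL ltba => /eqP ->; rewrite ltnn.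
have [q [eqAB [qn cut]]] : exists q, _ := balanced_cut nab he hf
  ltac:(by rewrite !fg).
pose f' v := if v < q then tperm a b (f v) else f v.
have fixed x y : y \notin [:: a; b] -> (tperm a b x == y) = (x == y).
  rewrite !inE negb_or => /andP[ya yb].
  by rewrite -[in LHS](tpermD (x:=a) (y:=b) (z:=y)) 1?eq_sym // (inj_eq perm_inj).
exists f' => [u v uv vn euv|c].
  have fuv := hf _ _ uv vn euv.
  rewrite /f'; case: (ltnP v q) => vq.
    by rewrite (ltn_trans uv vq) (inj_eq perm_inj).
  case: ifP => // uq.
  (* One end of a crossing edge has neither color, so the swap cannot make its ends equal. *)
  have := cut _ _ uq vq vn euv; rewrite negb_and => /orP[nu|nv].
    rewrite tpermD //; by move: nu; rewrite !inE negb_or eq_sym (eq_sym _ b) => /andP[].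
  by rewrite fixed.
have splitq (P : pred nat) : count P (iota 0 n) =
    count P (iota 0 q) + count P (iota q (n - q)).
  by rewrite -{1}(subnKC qn) iotaD count_cat.
have lo x : count (fun v => f' v == x) (iota 0 q) =
    count (fun v => f v == tperm a b x) (iota 0 q).
  apply: eq_in_count => v; rewrite mem_iota /= add0n /f' => ->.
  by rewrite -{1}(tpermK a b x) (inj_eq perm_inj).
have hi x : count (fun v => f' v == x) (iota q (n - q)) =
    count (fun v => f v == x) (iota q (n - q)).
  by apply: eq_in_count => v; rewrite mem_iota /f' => /andP[qv _]; rewrite ltnNge qv.
rewrite splitq lo hi /transfer; have := fg c; rewrite splitq.
case: tpermP => [->|->|/eqP/negPf -> /eqP/negPf ->] fgc.
- by rewrite eqxx (negPf nab) -fgc eqAB; lia.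
- by rewrite eqxx eq_sym (negPf nab) -fgc eqAB; lia.
by rewrite -fgc; lia.
Qed.

(* Move a vertex from a color [r] with [g r > a r] to the first color [s] with
   [g s < a s]; dominance gives [r < s], and then [g r > a r >= a s > g s]. *)
Lemma realizable_dominated (k : nat) e n (a g : 'I_k -> nat) :
  interval_rel e n -> realizable e n g ->
  (forall x y : 'I_k, x <= y -> a y <= a x) ->
  \sum_c a c = \sum_c g c ->
  (forall m, \sum_(c < k | c < m) a c <= \sum_(c < k | c < m) g c) ->
  realizable e n a.
Proof.
move=> he hg ha.
have [N] := ubnP (\sum_c (g c - a c)); elim: N g hg => // N IHN g hg ltN tot dom.
have [/existsP[s0 s0P]|/existsPn noS] := boolP [exists s, g s < a s]; last first.
  have eqag c : g c = a c.
    apply/eqP; rewrite eqn_leq andbC leqNgt noS /=.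
    rewrite leqNgt; apply/negP => ltc.
    move: tot; rewrite (bigD1 c) //= [RHS](bigD1 c) //= => tot.
    have : \sum_(i | i != c) a i <= \sum_(i | i != c) g i.
      by apply: leq_sum => i _; rewrite leqNgt noS.
    by move/(leq_add ltc); rewrite addSn tot ltnn.
  by case: hg => f hf fg; exists f => // c; rewrite fg eqag.
case: (@arg_minnP _ s0 (fun s => g s < a s) val s0P) => s sP smin.
have before (l : 'I_k) : l < s -> a l <= g l.
  by move=> ls; rewrite leqNgt; apply/negP => /smin; rewrite /= leqNgt ls.
(* Otherwise [g <= a] up to [s], strictly at [s], against dominance at [s.+1]. *)
have [r [rs rP]] : exists r : 'I_k, r < s /\ a r < g r.
  apply/'exists_andP; apply: contraT => /existsPn no.
  have /= := dom s.+1; rewrite (bigD1 s) //= [X in _ <= X](bigD1 s) //=.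
  have : \sum_(i < k | (i < s.+1) && (i != s)) g i
      <= \sum_(i < k | (i < s.+1) && (i != s)) a i.
    apply: leq_sum => i /andP[]; rewrite ltnS leq_eqVlt => /orP[/eqP/val_inj->|si _].
      by rewrite eqxx.
    by have := no i; rewrite si -leqNgt.
  by move=> /(leq_add sP) h1 h2; have := leq_trans h1 h2; rewrite addSn ltnn.
have nrs : r != s by apply: contraL rs => /eqP ->; rewrite ltnn.
have ars : a s <= a r by apply: ha; apply: ltnW.
have gr : 0 < g r by lia.
apply: (IHN (transfer r s g)).
- by apply: realizable_transfer => //; lia.
- suff : (\sum_c (transfer r s g c - a c)).+1 <= \sum_c (g c - a c) by lia.
  rewrite (bigD1 r) //= [X in _ <= X](bigD1 r) //= -addSn.
  apply: leq_add; first by rewrite /transfer eqxx (negPf nrs); lia.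
  apply: leq_sum => i /negPf ir; rewrite /transfer ir.
  by case: (eqVneq i s) => [->|]; lia.
- by rewrite tot; have := sum_transfer s predT gr; rewrite /= => /addIn ->.
(* For [m <= s] the sums compare term by term, as [a <= g] before [s]; for [m > s] both [r] and [s]
   are counted and the sum is unchanged. *)
move=> m; have [ms|sm] := leqP m s.
  apply: leq_sum => i im; have := before i (leq_trans im ms); rewrite /transfer.
  case: (eqVneq i r) => [->|]; lia.
have := sum_transfer s (fun c : 'I_k => c < m) gr.
by rewrite /= sm (ltn_trans rs sm) => /addIn ->.
Qed.

(** * First-fit colorings and their optimality *)

Definition first_fit (e : rel nat) (n : nat) (c : nat -> nat) : Prop :=
  proper_upto e n c /\
  forall v x, v < n -> x < c v -> exists u, [/\ u < v, e u v & c u = x].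

Lemma first_fit_exists e n : exists c, first_fit e n c.
Proof.
elim: n => [|n [c [hc1 hc2]]]; first by exists id; split.
pose used x := has (fun u => e u n && (c u == x)) (iota 0 n).
have free : exists x, ~~ used x.
  (* This exceeds every earlier color. *)
  exists (\sum_(u < n) c u).+1; apply/hasPn => u; rewrite mem_iota /= add0n => un.
  apply/negP => /andP[_ /eqP cu].
  rewrite (bigD1 (Ordinal un)) //= in cu; lia.
case: (ex_minnP free) => x0 x0free x0min.
exists (fun v => if v == n then x0 else c v); split.
  move=> u v uv; rewrite ltnS leq_eqVlt => /orP[/eqP vn|vn] euv.
    rewrite vn in uv euv *; rewrite eqxx (ltn_eqF uv).
    move/hasPn: x0free => /(_ u); rewrite mem_iota /= add0n uv euv => /(_ isT).
    by [].
  by rewrite (ltn_eqF vn) (ltn_eqF (ltn_trans uv vn)); apply: hc1.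
move=> v x; rewrite ltnS leq_eqVlt => /orP[/eqP ->|vn].
  rewrite eqxx => xx0.
  have /hasP[u] : used x by apply: contraLR xx0 => /x0min; rewrite -leqNgt.
  rewrite mem_iota /= add0n => un /andP[eun /eqP cu].
  by exists u; rewrite (ltn_eqF un).
rewrite (ltn_eqF vn) => /(hc2 _ _ vn) [u [uv euv cu]].
by exists u; rewrite (ltn_eqF (ltn_trans uv vn)).
Qed.

(** Take for [l] the least earlier neighbour of [v], or [v] itself if there is none; the interval
    property fills the rest. *)
Lemma back_neighbours e n v : interval_rel e n -> v < n ->
  exists2 l, l <= v & forall u, u < v -> e u v = (l <= u).
Proof.
move=> he vn.
have ex : exists l, (l == v) || (l < v) && e l v by exists v; rewrite eqxx.
case: (ex_minnP ex) => l lP lmin; exists l; first by apply: lmin; rewrite eqxx.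
move=> u uv; apply/idP/idP => [euv|lu]; first by apply: lmin; rewrite uv euv orbT.
case/orP: lP => [/eqP lv|/andP[lv elv]]; first by lia.
move: lu; rewrite leq_eqVlt => /orP[/eqP <- //|lu].
by have /andP[] := he _ _ _ lu uv vn elv.
Qed.

(* If first fit skips [v], its earlier neighbours [[l, v)] already carry all [r]
   colors of first fit, whereas the clique [[l, v]] has at most [r] vertices
   colored in [s]; so the comparison follows from the one at [l]. *)
Lemma first_fit_optimal (T : eqType) e n c (g : nat -> T) (s : seq T) :
  interval_rel e n -> first_fit e n c -> proper_upto e n g ->
  count (fun v => g v \in s) (iota 0 n) <=
  count (fun v => c v < size s) (iota 0 n).
Proof.
move=> he [cP cmin] gP; set r := size s.
suff H m : m <= n -> count (fun v => g v \in s) (iota 0 m) <=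
  count (fun v => c v < r) (iota 0 m) by apply: H.
elim/ltn_ind: m => -[|v] IH vn; first by [].
case: (ltnP (c v) r) => cv.
  rewrite !count_iotaS cv; apply: leq_add; last by case: (_ \in _).
  by apply: IH => //; apply: ltnW.
have [l lv lP] := back_neighbours he vn.
have split x : l <= x -> iota 0 x = iota 0 l ++ iota l (x - l).
  by move=> lx; rewrite -{1}(subnKC lx) iotaD.
rewrite [in X in X <= _](split v.+1) ?(leq_trans lv) // count_cat.
apply: (@leq_trans (count (fun v => c v < r) (iota 0 l) + r)).
  apply: leq_add; first by apply: IH; lia.
  rewrite -size_filter -(size_map g); apply: uniq_leq_size; last first.
    by move=> x /mapP[u]; rewrite mem_filter => /andP[? _] ->.
  have adj x y : l <= x -> x < y -> y <= v -> g x != g y.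
    move=> lx xy yv; apply: gP => //; first by lia.
    move: yv; rewrite leq_eqVlt => /orP[/eqP yv|yv]; first by rewrite yv lP //; lia.
    have exv : e x v by rewrite lP //; lia.
    by have /andP[] := he _ _ _ xy yv vn exv.
  rewrite map_inj_in_uniq ?filter_uniq ?iota_uniq // => x y.
  rewrite !mem_filter !mem_iota => /andP[_ /andP[lx xv]] /andP[_ /andP[ly yv]] gxy.
  have [xy|yx|//] := ltngtP x y.
    by have := adj _ _ lx xy; rewrite gxy eqxx; lia.
  by have := adj _ _ ly yx; rewrite gxy eqxx; lia.
apply: (@leq_trans (count (fun v => c v < r) (iota 0 v))); last first.
  by rewrite count_iotaS leq_addr.
rewrite (split v) // count_cat leq_add2l.
rewrite -size_filter -(size_map c) -[r in r <= _](size_iota 0 r).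
apply: uniq_leq_size; first exact: iota_uniq.
move=> x; rewrite mem_iota /= add0n => xr.
have [u [uv euv cu]] := cmin _ _ vn (leq_trans xr cv).
apply/mapP; exists u; rewrite // mem_filter cu xr mem_iota -lP // euv; lia.
Qed.

Lemma count_ltS (c : nat -> nat) r s :
  count (fun v => c v < r.+1) s
  = count (fun v => c v < r) s + count (fun v => c v == r) s.
Proof. by elim: s => //= v s ->; lia. Qed.

(* Otherwise the colors [0, ..., l.-1, l.+1] would beat first fit. *)
Lemma first_fit_sizes_decr e n c l : interval_rel e n -> first_fit e n c ->
  count (fun v => c v == l.+1) (iota 0 n) <= count (fun v => c v == l) (iota 0 n).
Proof.
move=> he hc.
have := first_fit_optimal (l.+1 :: iota 0 l) he hc hc.1.
rewrite /= size_iota count_ltS.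
have -> s : count (fun v => c v \in l.+1 :: iota 0 l) s
    = count (fun v => c v < l) s + count (fun v => c v == l.+1) s.
  elim: s => //= v s ->; rewrite in_cons mem_iota; lia.
by rewrite leq_add2l.
Qed.

(** * Submodularity and exchange in polymatroids *)

(** The increments of [rho] decrease, so [y] steps from [m + x] gain no more than [y] steps from
    [m]. With [m] the size of the intersection of two sets and [x], [y] those of their differences,
    this is submodularity of [rho #|S|]. *)
Lemma concave_submodular (rho : nat -> nat) m x y :
  (forall r, rho r.+2 + rho r <= (rho r.+1).*2) ->
  rho (m + x + y) + rho m <= rho (m + x) + rho (m + y).
Proof.
move=> conc.
have step i j : i <= j -> rho j.+1 + rho i <= rho j + rho i.+1.
  elim: j => [|j IHj]; first by case: i => //; rewrite addnC.
  rewrite leq_eqVlt => /orP[/eqP ->|ij]; first by rewrite addnC.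
  have := IHj ij; have := conc j; lia.
elim: y => [|y IHy]; first by rewrite !addn0.
have := step (m + y) (m + x + y); rewrite !addnS; lia.
Qed.

(* If no [j] worked, the largest tight set avoiding [i] would contain every [j]
   with [a j < b j], by submodularity, forcing the total of [a] to exceed that of [b]. *)
Lemma polymatroid_exchange (k : nat) (rho : nat -> nat) (a b : 'I_k -> nat) i :
  rho 0 = 0 -> (forall r, rho r.+2 + rho r <= (rho r.+1).*2) ->
  (forall S : {set 'I_k}, \sum_(c in S) a c <= rho #|S|) ->
  (forall S : {set 'I_k}, \sum_(c in S) b c <= rho #|S|) ->
  \sum_c a c = \sum_c b c -> b i < a i ->
  exists j, a j < b j /\
    forall S : {set 'I_k}, \sum_(c in S) transfer i j a c <= rho #|S|.
Proof.
move=> rho0 conc ha hb tot ltba.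
have ai : 0 < a i by lia.
pose tight (S : {set 'I_k}) := (i \notin S) && (\sum_(c in S) a c == rho #|S|).
have [/existsP[j /andP[jP /forallP jS]]|/existsPn no] :=
  boolP [exists j, (a j < b j) && [forall S, tight S ==> (j \notin S)]].
  exists j; split=> // S.
  (* A sum grows only if [S] contains [j] but not [i]; then [S] is not tight and has room for one
     more. *)
  have mv : \sum_(c in S) transfer i j a c + (i \in S)
      = \sum_(c in S) a c + (j \in S) by exact: sum_transfer.
  have := jS S; have := ha S; rewrite /tight leq_eqVlt.
  by case: (i \in S) mv; case: (j \in S) => /=; case: eqVneq => //=; lia.
have t0 : tight set0 by rewrite /tight inE big_set0 cards0 rho0.
case: (@arg_maxnP _ set0 tight (fun S => #|S|) t0) => T /andP[iT /eqP Ttight] Tmax.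
have sub j : a j < b j -> j \in T.
  move=> jP; have := no j; rewrite jP /= => /forallPn[S].
  rewrite negb_imply negbK => /andP[/andP[iS /eqP Stight] jS].
  (* Uncrossing two tight sets: the bound at the intersection and submodularity force equality at
     the union. *)
  have U : tight (S :|: T).
    rewrite /tight !inE (negPf iS) (negPf iT) /= eqn_leq ha /=.
    have := concave_submodular #|S :&: T| #|S :\: T| #|T :\: S| conc.
    have e1 : #|S :&: T| + #|S :\: T| = #|S| by apply: cardsID.
    have e2 : #|S :&: T| + #|T :\: S| = #|T| by rewrite setIC; apply: cardsID.
    have e3 : #|S :|: T| = #|S| + #|T :\: S|.
      by have := cardsUI S T; lia.
    rewrite e1 e2 -e3.
    have sIU : \sum_(c in S :|: T) a c + \sum_(c in S :&: T) a c
             = \sum_(c in S) a c + \sum_(c in T) a c.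
      rewrite !(big_mkcond (fun c => c \in _)) /= -!big_split /=.
      by apply: eq_bigr => c _; rewrite !inE; case: (c \in S); case: (c \in T); rewrite /= ?addn0.
    rewrite -Stight -Ttight -sIU => submod.
    by rewrite -(leq_add2r (rho #|S :&: T|)) (leq_trans submod) // leq_add2l.
  have /eqP -> : T == S :|: T by rewrite eqEcard subsetUr; apply: Tmax U.
  by rewrite inE jS.
(* Outside [T], [b <= a] with strict inequality at [i], while [b(T) <= rho #|T| = a(T)]. *)
have out : \sum_(c | c \notin T) b c < \sum_(c | c \notin T) a c.
  rewrite (bigD1 i) //= [X in _ < X](bigD1 i) //= -addSn leq_add //.
  apply: leq_sum => c /andP[cT _]; rewrite leqNgt; apply: contra cT; exact: sub.
move: tot; rewrite (bigID (mem T)) [RHS](bigID (mem T)) /= => tot.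
by have := leq_add (hb T) out; rewrite -Ttight addnS -tot ltnn.
Qed.

(** * Class sizes as the bases of a polymatroid *)

Lemma sorting_perm (k : nat) (a : 'I_k -> nat) :
  exists p : 'S_k, forall x y : 'I_k, x <= y -> a (p y) <= a (p x).
Proof.
pose leT := [rel x y : 'I_k | a y <= a x].
have tot : total leT by move=> x y /=; apply: leq_total.
have tr : transitive leT by move=> y x z /= yx zy; apply: leq_trans zy yx.
have pe : perm_eq (sort leT (ord_tuple k)) (ord_tuple k) by rewrite perm_sort.
have sz : size (sort leT (ord_tuple k)) == k by rewrite size_sort size_tuple.
case/tuple_permP: (pe) => p sP.
exists p => x y xy.
have nthp (z : 'I_k) : nth z (sort leT (ord_tuple k)) z = p z.
  by rewrite sP -tnth_nth tnth_map !tnth_ord_tuple.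
have := sorted_leq_nth tr (fun z => leqnn (a z)) x (sort_sorted tot (ord_tuple k)).
move=> /(_ x y); rewrite !inE (eqP sz) !ltn_ord => /(_ isT isT xy) /=.
by rewrite nthp (set_nth_default y) ?(eqP sz) // nthp.
Qed.

Lemma realizable_bound (k : nat) e n c (a : 'I_k -> nat) (S : {set 'I_k}) :
  interval_rel e n -> first_fit e n c -> realizable e n a ->
  \sum_(x in S) a x <= count (fun v => c v < #|S|) (iota 0 n).
Proof.
move=> he hc [f hf fa].
under eq_bigr => x _ do rewrite -fa.
rewrite sum_count_mem cardE.
have := first_fit_optimal (enum S) he hc hf.
by rewrite (eq_count (a2 := fun v => f v \in S)) // => v; rewrite mem_enum.
Qed.

Lemma realizable_total (k : nat) e n (a : 'I_k -> nat) :
  realizable e n a -> \sum_x a x = n.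
Proof.
case=> f _ fa; under eq_bigr => x _ do rewrite -fa.
rewrite -[RHS](_ : count (fun v => f v \in [set: 'I_k]) (iota 0 n) = n); last first.
  by rewrite (@eq_count _ _ predT) ?count_predT ?size_iota // => v; rewrite /= inE.
by rewrite -sum_count_mem; apply: eq_bigl => x; rewrite inE.
Qed.

(** Sorted decreasingly, [a] is dominated by the first-fit sizes, and Kempe exchanges lead from
    these to [a]. *)
Lemma realizable_of_bound (k : nat) e n c (a : 'I_k -> nat) :
  interval_rel e n -> first_fit e n c -> 0 < k -> \sum_x a x = n ->
  (forall S : {set 'I_k}, \sum_(x in S) a x
     <= count (fun v => c v < #|S|) (iota 0 n)) ->
  realizable e n a.
Proof.
case: k a => // k a he hc _ tot ha.
(* For the set of all colors the bound says that first fit stays within [k.+1] colors. *)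
have ck v : v < n -> c v < k.+1.
  move=> vn; have := ha [set: 'I_k.+1]; rewrite cardsT card_ord.
  under eq_bigl => x do rewrite inE.
  rewrite tot -{1}(size_iota 0 n) => le.
  have : all (fun v => c v < k.+1) (iota 0 n) by rewrite all_count eqn_leq le count_size.
  by move/allP => /(_ v); rewrite mem_iota; apply.
have [p ap] := sorting_perm a.
suff [f hf fa] : realizable e n (a \o p).
  exists (p \o f) => [u v uv vn euv|x] /=.
    by rewrite (inj_eq perm_inj); apply: hf.
  rewrite -[in RHS](permKV p x) -[RHS]/((a \o p) _) -fa.
  by apply: eq_count => v /=; rewrite -{1}(permKV p x) (inj_eq perm_inj).
pose f v : 'I_k.+1 := inord (c v).
have hg : realizable e n (fun x => count (fun v => f v == x) (iota 0 n)).
  exists f => // u v uv vn euv; apply: contraNneq (hc.1 _ _ uv vn euv).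
  by move=> /(congr1 val) /=; rewrite !inordK ?ck // ?(ltn_trans uv) // => ->.
apply: (realizable_dominated he hg) => //.
  rewrite (realizable_total hg) -tot [RHS](reindex_inj (@perm_inj _ p)).
  by [].
move=> m; pose S := [set x : 'I_k.+1 | x < m].
have SE (F : 'I_k.+1 -> nat) : \sum_(x < k.+1 | x < m) F x = \sum_(x in S) F x.
  by apply: eq_bigl => x; rewrite inE.
rewrite !SE sum_count_mem.
have -> : \sum_(x in S) (a \o p) x = \sum_(x in p @: S) a x.
  by rewrite big_imset //=; move=> ? ? _ _; apply: perm_inj.
apply: leq_trans (ha _) _; rewrite card_imset; last exact: perm_inj.
(* Only an inequality, as [m] may exceed the number of colors. *)
have Sm : #|S| <= m.
  rewrite cardE -(size_map val) -[m in _ <= m](size_iota 0 m).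
  apply: uniq_leq_size; first by rewrite map_inj_uniq ?enum_uniq //; apply: val_inj.
  by move=> x /mapP[y]; rewrite mem_enum inE mem_iota => ? ->.
rewrite (eq_in_count (a1 := fun v => f v \in S) (a2 := fun v => c v < m)).
  by apply: sub_count => v /= h; apply: leq_trans h Sm.
by move=> v; rewrite mem_iota /= add0n => vn; rewrite inE inordK ?ck.
Qed.

Lemma realizable_exchange (k : nat) e n (a b : 'I_k -> nat) i :
  interval_rel e n -> realizable e n a -> realizable e n b -> b i < a i ->
  exists j, a j < b j /\ realizable e n (transfer i j a).
Proof.
move=> he ra rb ltba.
have [c hc] := first_fit_exists e n.
have k0 : 0 < k by apply: leq_ltn_trans (ltn_ord i).
pose rho r := count (fun v => c v < r) (iota 0 n).
have rho0 : rho 0 = 0 by rewrite /rho; elim: (iota 0 n).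
(* The increments of [rho] are the first-fit class sizes, which decrease. *)
have rho_concave r : rho r.+2 + rho r <= (rho r.+1).*2.
  by have := first_fit_sizes_decr r he hc; rewrite /rho !count_ltS; lia.
have tot : \sum_x a x = \sum_x b x.
  by rewrite (realizable_total ra) (realizable_total rb).
have [j [jP jS]] := polymatroid_exchange rho0 rho_concave
  (fun S => realizable_bound S he hc ra) (fun S => realizable_bound S he hc rb)
  tot ltba.
exists j; split=> //; apply: (realizable_of_bound he hc k0) => //.
have ai : 0 < a i by apply: leq_ltn_trans ltba.
by have := sum_transfer j predT ai; rewrite (realizable_total ra) => /addIn.
Qed.

(** * From Dyck paths and chromatic polynomials to class sizes *)

(** The [e] steps are listed from left to right, so the prefix of [d] taken for [u] is a prefix of
    that for [v]; both indices are in range since [d] has [n] such steps. *)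
Lemma hessenberg_homo n d : count_mem false d = n ->
  forall u v, u <= v -> v < n -> hessenberg d u <= hessenberg d v.
Proof.
move=> dn u v uv vn.
have sz : size (east_positions d) = n.
  rewrite size_filter -dn -{3}(mkseq_nth true d) /mkseq count_map.
  by apply: eq_count.
have srt : sorted leq (east_positions d).
  by apply: sorted_filter; [exact: leq_trans | exact: iota_sorted].
have : nth 0 (east_positions d) u <= nth 0 (east_positions d) v.
  apply: (sorted_leq_nth leq_trans leqnn) => //; rewrite inE sz //.
  exact: leq_ltn_trans vn.
rewrite /hessenberg => /take_takel <-.
move: (take _ d) => t.
by rewrite -{2}(cat_take_drop (nth 0 (east_positions d) u) t) count_cat leq_addr.
Qed.

(** Every proper coloring contributes a monomial with coefficient 1, so nothing cancels. *)
Lemma msupp_chromatic (V : finType) (e : rel V) k (m : 'X_{1..k}) :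
  (m \in msupp (chromatic_sympoly e k)) =
  [exists f : {ffun V -> 'I_k}, proper_coloring e f
     && [forall c, #|[pred v | f v == c]| == m c]].
Proof.
have coefE (f : {ffun V -> 'I_k}) :
    ((\prod_(v : V) 'X_(f v))@_m : int)%R
      = [forall c, #|[pred v | f v == c]| == m c]%:R%R.
  rewrite mprodXE mcoeffX; congr (nat_of_bool _)%:R%R.
  apply/eqP/forallP => [<- c|H]; last first.
    apply/mnmP => c; rewrite mnm_sumE -(eqP (H c)) -sum1_card [RHS]big_mkcond.
    by apply: eq_bigr => v _; rewrite mnm1E.
  rewrite mnm_sumE -sum1_card big_mkcond; apply/eqP.
  by apply: eq_bigr => v _; rewrite mnm1E.
rewrite mcoeff_msupp /chromatic_sympoly GRing.raddf_sum /=.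
under eq_bigr => f _ do rewrite coefE.
rewrite -GRing.natr_sum Num.Theory.pnatr_eq0 sum_nat_eq0.
apply/forallPn/existsP => -[f].
  by rewrite negb_imply => /andP[pf fm]; exists f; rewrite pf; case: forallP fm.
by move=> /andP[pf fm]; exists f; rewrite pf fm.
Qed.

Lemma msupp_realizable n d k (i0 : 'I_k) (m : 'X_{1..k}) :
  m \in msupp (chromatic_sympoly (indifference_graph n d) k) <->
  realizable (fun u v => v < hessenberg d u) n m.
Proof.
have cnt (P : pred nat) : count P (iota 0 n) = #|[pred v : 'I_n | P v]|.
  by rewrite -val_enum_ord count_map -sum1_count -sum1_card big_enum_cond.
rewrite msupp_chromatic; split.
  case/existsP=> f /andP[/forallP pf /forallP fm].
  (* [i0] colors the numbers outside ['I_n], which are never inspected. *)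
  pose g v := if insub v is Some w then f w else i0.
  have gE (v : 'I_n) : g v = f v by rewrite /g valK.
  exists g => [u v uv vn euv|c].
    have := pf (Ordinal (ltn_trans uv vn)) => /forallP/(_ (Ordinal vn)).
    by rewrite /indifference_graph /= uv euv /= -!gE.
  by rewrite cnt -(eqP (fm c)); apply: eq_card => v; rewrite !inE gE.
case=> g pg gm; apply/existsP; exists [ffun v : 'I_n => g v]; apply/andP; split.
  apply/forallP => u; apply/forallP => v; apply/implyP; rewrite !ffunE.
  case/orP=> /andP[uv euv]; first exact: pg.
  by rewrite eq_sym; apply: pg.
apply/forallP => c; rewrite -gm cnt; apply/eqP.
by apply: eq_card => v; rewrite !inE ffunE.
Qed.

Theorem corollary4p3 (n : nat) (d : seq bool) (hd : dyck_path n d)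
    (k : nat) (hk : (1 <= k)%N) :
  M_convex (fun alpha : 'X_{1..k} =>
    alpha \in msupp (chromatic_sympoly (indifference_graph n d) k)).
Proof.
move=> alpha beta hal hbe i ltba.
case: hd => _ de _.
(* With [h] for [hessenberg d], [w < v < h(u)] gives one edge and [v < h(u) <= h(w)] the other. *)
have he : interval_rel (fun u v => v < hessenberg d u) n.
  move=> u w v uw wv vn vu; rewrite (ltn_trans wv vu) /=.
  apply: leq_trans vu _; apply: (hessenberg_homo de) => //; first exact: ltnW.
  exact: ltn_trans vn.
have [j [jP [f hf fa]]] := realizable_exchange he
  ((msupp_realizable n d i alpha).1 hal) ((msupp_realizable n d i beta).1 hbe) ltba.
exists j; split=> //; apply/(msupp_realizable n d i _); exists f => // c.
by rewrite fa mnmDE mnmBE !mnm1E /transfer !(eq_sym c).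
Qed.
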